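(* Let $n\ge m\ge 1$ be integers and write $m=3\ell+r$ with $\ell\ge 0$ an integer and $r\in\{0,1,2\}$. Then \[ T(n,m)\le \begin{cases} \left(\frac{3}{2}\right)^n\dfrac{6(3\ell+2)2^{2\ell+1}}{\binom{n}{2\ell+1}} & \text{if } r=2,\\[10pt] \left(\frac{3}{2}\right)^n\dfrac{3(3\ell+1)2^{2\ell}}{\binom{n}{2\ell}} & \text{if } r=1,\\[10pt] \left(\frac{3}{2}\right)^n\dfrac{6\ell\, 2^{2\ell-1}}{\binom{n}{2\ell-1}} & \text{if } r=0. \end{cases} \]
   Context: Three words $x,y,z\in\{0,1,2\}^n$ triffer at position $i$ if $\{x_i,y_i,z_i\}=\{0,1,2\}$. For integers $n\ge m\ge 1$, a code $C\subseteq\{0,1,2\}^n$ is $m$-trifferent if any three distinct codewords of $C$ triffer in at least $m$ positions. $T(n,m)$ denotes the largest size of an $m$-trifferent code $C\subseteq\{0,1,2\}^n$. *)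

(* Defs.v *)
From mathcomp Require Import all_boot.

Set Implicit Arguments.
Unset Strict Implicit.
Unset Printing Implicit Defensive.

Definition word (n : nat) := {ffun 'I_n -> 'I_3}.

Definition triffer_at (n : nat) (x y z : word n) (i : 'I_n) : bool :=
  [set x i; y i; z i] == [set: 'I_3].

Definition trifferent (n m : nat) (C : {set word n}) : bool :=
  [forall x in C, forall y in C, forall z in C,
    [&& x != y, y != z & x != z] ==>
    (m <= #|[set i : 'I_n | triffer_at x y z i]|)].

Definition T (n m : nat) : nat :=
  \max_(C : {set word n} | trifferent m C) #|C|.

(* Main.v *)
Require Import Defs.
From mathcomp Require Import all_boot all_order all_algebra.
From mathcomp Require Import zify.

(** Fix a word [w] and let [S] be the set of codewords agreeing with [w] in
    exactly [k] positions.  A position where three codewords of [S] triffer is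
    one where exactly one of them agrees with [w]; there are few agreements in
    total, so a Plotkin-type double count over the ordered triples of [S] gives
    [(2m - 3k)(#|S| - 1) <= 2m] as soon as [#|S| >= 3].  Averaging over all [w]
    then yields [#|C| * 'C(n, k) * 2 ^ (n - k) <= 3 ^ n * max #|S|].  The
    theorem takes for [k] the largest integer with [3k < 2m]. *)

Set Implicit Arguments.
Unset Strict Implicit.
Unset Printing Implicit Defensive.

Import Order.TTheory GRing.Theory Num.Theory.
Local Open Scope ring_scope.

Definition agreement (n : nat) (x w : word n) : {set 'I_n} :=
  [set i | x i == w i].

Definition column (n : nat) (S : {set word n}) (i : 'I_n) (a : 'I_3) : nat :=
  #|[set x in S | x i == a]|.

Section Counting.
Local Open Scope nat_scope.

(** On [A] the word [w] must copy [x]; every other position leaves two values. [F i] collects the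
    values allowed at [i]. *)
Lemma card_agreement_eq n (x : word n) (A : {set 'I_n}) :
  #|[set w | agreement x w == A]| = 2 ^ (n - #|A|).
Proof.
pose F i := if i \in A then pred1 (x i) else predC1 (x i).
have -> : #|[set w | agreement x w == A]| = #|family F|.
  apply: eq_card => w; rewrite inE; apply/eqP/familyP => [defA i | Fw].
    by rewrite /F -defA inE; case: eqP => [->|/eqP]; rewrite !inE // eq_sym.
  apply/setP=> i; rewrite inE; have := Fw i; rewrite /F.
  by case: (i \in A); rewrite !inE eq_sym // => /negbTE.
rewrite card_family foldrE big_map big_enum /=.
rewrite (bigID (mem A)) /= [X in X * _]big1 ?mul1n => [|i Ai]; last first.
  by rewrite /F Ai card1.
rewrite (eq_bigr (fun=> 2)) => [|i /negbTE Ai]; last first.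
  by rewrite /F Ai cardC1 card_ord.
rewrite prod_nat_const; congr (2 ^ _).
by rewrite -[n in n - _]card_ord -(cardC A) addKn.
Qed.

Lemma card_agreement n (x : word n) k :
  #|[set w | #|agreement x w| == k]| = 'C(n, k) * 2 ^ (n - k).
Proof.
rewrite -sum1dep_card (partition_big (agreement x) (fun A => #|A| == k)) //=.
rewrite (eq_bigr (fun=> 2 ^ (n - k))) => [|A /eqP Ak].
  by rewrite sum_nat_const -[n in 'C(n, _)]card_ord -card_draws cardsE.
rewrite -Ak -(card_agreement_eq x) -sum1dep_card; apply: eq_bigl => w.
by rewrite andb_idl // => /eqP->.
Qed.

(** Double count of the pairs of a codeword [x] and a word [w] that agree in exactly [k] positions:
    first by [x], then by [w]. *)
Lemma card_le_of_agreement_bound n k M (C : {set word n}) :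
  (forall w, #|[set x in C | #|agreement x w| == k]| <= M) ->
  #|C| * ('C(n, k) * 2 ^ (n - k)) <= 3 ^ n * M.
Proof.
move=> leM; rewrite -sum_nat_const.
under eq_bigr => x _ do rewrite -(card_agreement x) -sum1dep_card.
rewrite (exchange_big_dep predT) //=.
have -> : 3 ^ n * M = \sum_(w : word n) M.
  by rewrite sum_nat_const card_ffun !card_ord.
by apply: leq_sum => w _; rewrite sum1dep_card.
Qed.

Lemma sum_column n (S : {set word n}) w k :
  {in S, forall x, #|agreement x w| = k} ->
  \sum_i column S i (w i) = #|S| * k.
Proof.
move=> Sk; rewrite -sum_nat_const.
under eq_bigr => i _ do rewrite /column -sum1dep_card.
rewrite (exchange_big_dep (mem S)) /=; last by move=> i x _ /andP[].
apply: eq_bigr => x xS; rewrite -(Sk x xS) -sum1dep_card.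
by apply: eq_bigl => i; rewrite xS.
Qed.

Lemma triffer_at_neq n (x y z : word n) i :
  triffer_at x y z i -> [&& x i != y i, y i != z i & x i != z i].
Proof.
move/eqP/(congr1 (fun A : {set 'I_3} => #|A|)).
rewrite cardsT card_ord.
have le2 (u v : 'I_3) : #|[set u; v]| < 3 by rewrite cards2; case: (u != v).
case: (x i =P y i) => [->|_].
  by rewrite setUid => e; have := le2 (y i) (z i); rewrite e.
case: (y i =P z i) => [->|_].
  by rewrite -setUA setUid => e; have := le2 (x i) (z i); rewrite e.
case: (x i =P z i) => [->|_] //.
by rewrite setUAC setUid => e; have := le2 (z i) (y i); rewrite e.
Qed.

(* The six terms are the ways of assigning [a], [b], [c] to the triple. *)
Lemma triple_indicator (a b c u v s : 'I_3) :
  a != b -> b != c -> a != c -> [&& u != v, v != s & u != s] ->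
  0 < (u == a) * ((v == b) * (s == c)) + (u == a) * ((v == c) * (s == b))
    + (u == b) * ((v == a) * (s == c)) + (u == b) * ((v == c) * (s == a))
    + (u == c) * ((v == a) * (s == b)) + (u == c) * ((v == b) * (s == a)).
Proof. by move: a b c u v s; do 6!case=> [[|[|[|//]]] ?]. Qed.

Lemma sum_triples n (S : {set word n}) i (a b c : 'I_3) :
  \sum_(x in S) \sum_(y in S) \sum_(z in S)
     (x i == a) * ((y i == b) * (z i == c)) =
  column S i a * (column S i b * column S i c).
Proof.
have colE d : column S i d = \sum_(x in S) (x i == d).
  rewrite /column -sum1dep_card big_mkcondr /=.
  by apply: eq_bigr => x _; case: eqP.
rewrite !colE big_distrl /=; apply: eq_bigr => x _.
rewrite big_distrl big_distrr /=; apply: eq_bigr => y _.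
by rewrite -!big_distrr.
Qed.

(** Each of the six orders of the values [a], [b], [c] is taken by as many triples as the product of
    the three columns. *)
Lemma sum_triffer_at n (S : {set word n}) i (a b c : 'I_3) :
  a != b -> b != c -> a != c ->
  \sum_(x in S) \sum_(y in S) \sum_(z in S) triffer_at x y z i
    <= 6 * (column S i a * (column S i b * column S i c)).
Proof.
move=> ab bc ac.
pose t (p q r : 'I_3) (x y z : word n) := (x i == p) * ((y i == q) * (z i == r)).
apply: (@leq_trans (\sum_(x in S) \sum_(y in S) \sum_(z in S)
   (t a b c x y z + t a c b x y z + t b a c x y z + t b c a x y z
    + t c a b x y z + t c b a x y z))).
  apply: leq_sum => x _; apply: leq_sum => y _; apply: leq_sum => z _.
  case h: (triffer_at x y z i) => //.
  exact/(triple_indicator ab bc ac)/triffer_at_neq.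
under eq_bigr => x _ do (under eq_bigr => y _ do rewrite !big_split /=;
  rewrite !big_split /=).
rewrite !big_split /= /t !sum_triples.
lia.
Qed.

Lemma column_sum n (S : {set word n}) i (a b c : 'I_3) :
  a != b -> b != c -> a != c ->
  column S i a + column S i b + column S i c = #|S|.
Proof.
move=> ab bc ac.
rewrite /column -!sum1dep_card !big_mkcondr /= -!big_split /= -sum1_card.
apply: eq_bigr => x _.
by move: (x i) ab bc ac; move: a b c; do 4!case=> [[|[|[|//]]] ?].
Qed.

(** The other two columns [q], [r] are removed by AM-GM, [4qr <= (q + r)^2]. The result is linear in
    the column of [a], so with [a = w i] it can be summed over [i] by [sum_column]. *)
Lemma sum_triffer_at_le n (S : {set word n}) i (a : 'I_3) :
  2 * (\sum_(x in S) \sum_(y in S) \sum_(z in S) triffer_at x y z i)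
    <= 3 * (column S i a * #|S|.-1 ^ 2).
Proof.
have [b [c [ab bc ac]]] : exists b c : 'I_3, [/\ a != b, b != c & a != c].
  exists (ordS a), (ordS (ordS a)).
  by case: a => [[|[|[|//]]] ?].
have := sum_triffer_at S i ab bc ac; have := column_sum S i ab bc ac.
move: (\sum_(x in S) _) (column S i a) (column S i b) (column S i c) #|S|.
move=> t p q r M <- le_t.
(* If [p = 0], no triple triffers here; otherwise [q + r <= #|S| - 1], which is where the
   predecessor comes from. *)
case: p le_t => [|p] le_t; first by rewrite !mul0n in le_t *; lia.
have qr : 4 * (q * r) <= (p.+1 + q + r).-1 ^ 2.
  by apply: leq_trans (nat_AGM2 q r) _; rewrite leq_exp2r //; lia.
by have := leq_mul (leqnn p.+1) qr; lia.
Qed.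

Lemma trifferent_triples n m (S : {set word n}) :
  trifferent m S ->
  #|S| * (#|S|.-1 * (#|S|.-2 * m)) <=
  \sum_i \sum_(x in S) \sum_(y in S) \sum_(z in S) triffer_at x y z i.
Proof.
move=> /forall_inP trS.
have -> : \sum_i \sum_(x in S) \sum_(y in S) \sum_(z in S) triffer_at x y z i =
    \sum_(x in S) \sum_(y in S) \sum_(z in S) #|[set i | triffer_at x y z i]|.
  rewrite exchange_big /=; apply: eq_bigr => x _.
  rewrite exchange_big /=; apply: eq_bigr => y _.
  rewrite exchange_big /=; apply: eq_bigr => z _.
  rewrite -sum1dep_card [RHS]big_mkcond /=.
  by apply: eq_bigr => i _; case: triffer_at.
rewrite -sum_nat_const; apply: leq_sum => x xS.
have cardSx : #|S :\ x| = #|S|.-1 by rewrite (cardsD1 x S) xS.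
(* Only triples of distinct codewords are kept: the term [y = x], and later [z = x] and [z = y], are
   dropped. *)
rewrite (big_setD1 x) //= -cardSx -sum_nat_const.
apply: leq_trans (leq_addl _ _); apply: leq_sum => y ySx.
have cardSxy : #|S :\ x :\ y| = #|S :\ x|.-1 by rewrite (cardsD1 y (S :\ x)) ySx.
have yS : y \in S by case/setD1P: ySx.
rewrite (big_setD1 x) //= (big_setD1 y) //= -cardSxy -sum_nat_const addnA.
apply: leq_trans (leq_addl _ _); apply: leq_sum => z.
rewrite !inE => /and3P[zy zx zS].
have /forall_inP/(_ y yS)/forall_inP/(_ z zS)/implyP := trS x xS; apply.
by case/setD1P: ySx => yx _; rewrite eq_sym yx eq_sym zy eq_sym zx.
Qed.

(** The lower and upper bounds on the triffering triples share the factor [#|S| * (#|S| - 1)], which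
    cancels. *)
Lemma agreement_plotkin n m k (S : {set word n}) w :
  trifferent m S -> {in S, forall x, #|agreement x w| = k} -> 2 < #|S| ->
  2 * m * #|S|.-2 <= 3 * k * #|S|.-1.
Proof.
move=> /trifferent_triples le_tr Sk S3.
have : 2 * (#|S| * (#|S|.-1 * (#|S|.-2 * m))) <= 3 * ((#|S| * k) * #|S|.-1 ^ 2).
  apply: leq_trans (leq_mul (leqnn 2) le_tr) _.
  rewrite -(sum_column Sk) big_distrl !big_distrr /=.
  by apply: leq_sum => i _; apply: sum_triffer_at_le.
have S0 : 0 < #|S| * #|S|.-1 by rewrite muln_gt0; lia.
move=> h; rewrite -(leq_pmul2l S0).
by move: h; congr (_ <= _); lia.
Qed.

Lemma trifferentS n m (S C : {set word n}) :
  S \subset C -> trifferent m C -> trifferent m S.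
Proof.
move=> /subsetP sSC /forall_inP trC.
apply/forall_inP => x xS; apply/forall_inP => y yS; apply/forall_inP => z zS.
by have /forall_inP/(_ y (sSC y yS))/forall_inP/(_ z (sSC z zS)) :=
  trC x (sSC x xS).
Qed.

Lemma T_le n m k M :
  (forall s, 2 < s -> 2 * m * s.-2 <= 3 * k * s.-1 -> s <= M) -> 1 < M ->
  T n m * ('C(n, k) * 2 ^ (n - k)) <= 3 ^ n * M.
Proof.
move=> boundM M2.
have [C trC ->] : {C : {set word n} | trifferent m C & T n m = #|C|}.
  apply: (@eq_bigmax_cond _ (fun C : {set word n} => trifferent m C)).
  apply/card_gt0P; exists set0.
  by apply/forall_inP => x; rewrite inE.
apply: card_le_of_agreement_bound => w.
set S := [set x in C | _].
(* A class of at most two codewords contains no triple to count; [1 < M] covers it. *)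
have [/leq_trans->//|S3] := leqP #|S| 2.
apply: boundM => //; apply: (@agreement_plotkin _ _ _ _ w) => //.
  by apply: trifferentS trC; apply/subsetP => x; rewrite inE => /andP[].
by move=> x; rewrite inE => /andP[_ /eqP].
Qed.

End Counting.

Lemma T_le_rat n m k M :
  (forall s, 2 < s -> 2 * m * s.-2 <= 3 * k * s.-1 -> s <= M)%N ->
  (1 < M)%N -> (k <= n)%N ->
  (T n m)%:R <= (3%:R / 2%:R) ^+ n * ((M * 2 ^ k)%:R / 'C(n, k)%:R) :> rat.
Proof.
move=> boundM M2 kn.
have C0 : 0 < 'C(n, k)%:R :> rat by rewrite ltr0n bin_gt0.
have h : (T n m * 'C(n, k) * 2 ^ n <= 3 ^ n * (M * 2 ^ k))%N.
  have -> : (2 ^ n = 2 ^ (n - k) * 2 ^ k)%N by rewrite -expnD subnK.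
  by rewrite !mulnA leq_mul2r -!mulnA T_le ?orbT.
rewrite mulrA ler_pdivlMr // expr_div_n mulrAC ler_pdivlMr ?exprn_gt0 //.
by rewrite -!natrX -!natrM ler_nat.
Qed.

Theorem theorem1p5 (n m l r : nat) (hm : (1 <= m)%N) (hn : (m <= n)%N)
    (hr : (r < 3)%N) (hmr : m = (3 * l + r)%N) :
  (T n m)%:R <=
    (match r with
     | 2 => (3%:R / 2%:R) ^+ n *
              ((6 * (3 * l + 2) * 2 ^ (2 * l + 1))%:R / 'C(n, 2 * l + 1)%:R)
     | 1 => (3%:R / 2%:R) ^+ n *
              ((3 * (3 * l + 1) * 2 ^ (2 * l))%:R / 'C(n, 2 * l)%:R)
     | _ => (3%:R / 2%:R) ^+ n *
              ((6 * l * 2 ^ (2 * l - 1))%:R / 'C(n, 2 * l - 1)%:R)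
     end : rat).
Proof.
(* For [r = 0, 1, 2], [k] is [2l - 1], [2l], [2l + 1] and [2m - 3k] is 3, 2, 1. Hence [s] is at most
   [2l + 1], [m + 1], [2m + 1], within [M], which is [2m], [3m], [6m]. For [r = 0], [1 <= m] forces
   [l >= 1], so [2l - 1] is not truncated. *)
by case: r hr hmr => [|[|[|//]]] _ hmr; apply: T_le_rat; lia.
Qed.
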